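(* For every infinite cardinal $\kappa$ there is a $\mathcal C(\kappa)$-space that is hereditarily $\kappa$-resolvable (and hence maximally resolvable) but not extraresolvable.
   Context: For a space $X$, $\Delta(X)$ is the minimum cardinality of a nonempty open subset of $X$, and $\operatorname{nwd}(X)$ is the minimum cardinality of a somewhere dense (i.e. not nowhere dense) subset of $X$. $X$ is NODEC if all nowhere dense subsets of $X$ are closed (hence closed discrete). $D(2)$ is the discrete two-point space. For an infinite cardinal $\kappa$, a $\mathcal C(\kappa)$-space is a dense NODEC subspace $X$ of the Cantor cube $D(2)^{2^\kappa}$ with $|X|=\operatorname{nwd}(X)=\Delta(X)=\kappa$. $X$ is $\kappa$-resolvable if it contains $\kappa$ many pairwise disjoint dense subsets, and maximally resolvable if it is $\Delta(X)$-resolvable. A space is crowded if it has no isolated points; $X$ is hereditarily $\kappa$-resolvable if all (nonempty) crowded subspaces of $X$ are $\kappa$-resolvable. $X$ is extraresolvable if there are $\Delta(X)^+$ many dense subsets of $X$ such that any two of them have nowhere dense intersection. *)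

(* Defs.v *)
From mathcomp Require Import all_boot.
From mathcomp Require Import all_classical topology.

Set Implicit Arguments.
Unset Strict Implicit.
Unset Printing Implicit Defensive.

Local Open Scope classical_set_scope.
Local Open Scope card_scope.

(* A cardinal is represented by a type [K] of that cardinality; two cardinals
   are compared through [#<=] and [#=] on the full sets. A subspace [A] of a
   topological space is the type [set_type A] with the initial topology of the
   inclusion, so that [nowhere_dense], [nodec], etc. are always relative to the
   space itself, never to an ambient space. *)

Definition is_min_card (T : Type) (P : set (set T)) (K : Type) : Prop :=
  (exists2 A : set T, P A & A #= [set: K]) /\
  (forall A : set T, P A -> [set: K] #<= A).

Definition card_lt (K L : Type) : Prop :=
  [set: K] #<= [set: L] /\ ~ ([set: L] #<= [set: K]).

(* [L] has cardinality [K]^+ *)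
Definition is_succ_card (K L : Type) : Prop :=
  card_lt K L /\ (forall M : Type, card_lt K M -> [set: L] #<= [set: M]).

Definition nowhere_dense (T : topologicalType) (A : set T) : Prop :=
  interior (closure A) = set0.

(* Delta(T) = |K| *)
Definition is_dispersion_character (T : topologicalType) (K : Type) : Prop :=
  is_min_card [set U : set T | open U /\ U !=set0] K.

(* nwd(T) = |K| *)
Definition is_nwd (T : topologicalType) (K : Type) : Prop :=
  is_min_card [set A : set T | ~ nowhere_dense A] K.

Definition nodec (T : topologicalType) : Prop :=
  forall A : set T, nowhere_dense A -> closed A.

Definition crowded (T : topologicalType) : Prop :=
  isolated [set: T] = set0.

Definition resolvable (K : Type) (T : topologicalType) : Prop :=
  exists F : set (set T),
    [/\ F #= [set: K],
        forall A, F A -> dense A &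
        forall A B, F A -> F B -> A <> B -> A `&` B = set0].

Definition maximally_resolvable (T : topologicalType) : Prop :=
  exists2 K : Type, is_dispersion_character T K & resolvable K T.

Definition hereditarily_resolvable (K : Type) (T : topologicalType) : Prop :=
  forall Y : set T,
    Y !=set0 -> crowded (set_type Y) -> resolvable K (set_type Y).

Definition extraresolvable (T : topologicalType) : Prop :=
  exists K L : Type,
    [/\ is_dispersion_character T K,
        is_succ_card K L &
        exists F : set (set T),
          [/\ F #= [set: L],
              forall A, F A -> dense A &
              forall A B, F A -> F B -> A <> B -> nowhere_dense (A `&` B)]].

(* D(2)^(2^K): [bool] carries the discrete topology, [prod_topology] the
   product topology *)
Definition cantor_cube (K : Type) : topologicalType :=
  prod_topology (fun _ : K -> bool => bool).

Definition C_space (K : Type) (X : set (cantor_cube K)) : Prop :=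
  [/\ dense X,
      nodec (set_type X),
      X #= [set: K],
      is_nwd (set_type X) K &
      is_dispersion_character (set_type X) K].

(* Main.v *)
Require Import Defs.
From mathcomp Require Import all_boot.
From mathcomp Require Import all_classical topology.
From mathcomp Require wochoice.

(** The space is a set of [K]-many points of the cube whose topology is forced
    by a tree of dense sets. Suppose that a space [T] carries dense sets [D s],
    indexed by the finite sequences [s] over [K], such that the [D (rcons s i)]
    are pairwise disjoint subsets of [D s], and such that every [A] either is
    closed and nowhere dense or contains [U `&` D s] for some [s] and some
    nonempty open [U] ([tree_forced]). Then:
    - [T] is nodec, and every somewhere dense set, in particular every nonempty
      open set, has at least [K] points, one in each [U `&` D (rcons s i)];
    - a crowded [Y] is somewhere dense near each of its points, so it contains
      pieces [U `&` D s] for a family of disjoint open sets [U] that is dense in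
      [Y]; each piece splits into the dense sets [U `&` D (rcons s i)], and this
      makes [Y] [K]-resolvable;
    - there are only [K]-many sequences [s] and [K]-many points, so among more
      than [K] dense sets two contain pieces [U `&` D s] and [V `&` D s] with
      the same [s] and intersecting [U] and [V]; their intersection is somewhere
      dense, and [T] is not extraresolvable.

    The space itself is obtained by transfinite recursion ([forced_code]). The
    coordinates of the cube are grouped into as many countable blocks as there
    are subsets of the point set. A Hausdorff style independent family
    ([base_code]) makes all the [D s] dense to start with. The subsets [A] of
    the point set are then treated one after the other. If the current code has
    a cylinder whose trace on some [D s] lies in [A], the finitely many blocks
    involved are frozen, and [A] contains that trace for good. Otherwise an
    unused block is sacrificed: in each of its coordinates the value of every
    point of [A] becomes [false]. The [D s] remain dense, because every cylinder
    has points of [D s] outside [A], where nothing changes, and [A] becomes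
    closed and nowhere dense. An unused block exists at each stage because
    fewer stages than blocks came before and each used finitely many blocks
    ([initial_well_order_fresh]); this rests on [square_injects], the equality
    of an infinite cardinal with its square. *)

Set Implicit Arguments.
Unset Strict Implicit.
Unset Printing Implicit Defensive.

Local Open Scope classical_set_scope.

(** * Cardinal arithmetic *)

Definition injects (A B : Type) := exists f : A -> B, injective f.

Lemma injects_trans A B C : injects A B -> injects B C -> injects A C.
Proof. by move=> [f fI] [g gI]; exists (g \o f); exact: inj_comp. Qed.

Lemma injects_prod A B C D :
  injects A B -> injects C D -> injects (A * C) (B * D).
Proof.
move=> [f fI] [g gI]; exists (fun x => (f x.1, g x.2)).
by move=> [a c] [a' c'] [/fI -> /gI ->].
Qed.

Lemma injects_set_type T (A B : set T) : A `<=` B -> injects A B.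
Proof.
move=> AB; exists (fun x : A => SigSub (mem_set (AB _ (set_valP x)))).
by move=> x y [] /val_inj.
Qed.

Lemma card_leP_injects T U (A : set T) (B : set U) : (A #<= B)%card <-> injects A B.
Proof.
split=> [/card_leP[f]|[f fI]].
  by exists f => x y; apply: inj; rewrite inE.
by apply/card_leP; apply/injfunPex; exists f => // x y _ _; exact: fI.
Qed.

Lemma injects_setT (A : Type) : injects [set: A] A /\ injects A [set: A].
Proof.
split; first by exists val; exact: val_inj.
by exists (fun a => SigSub (mem_set (I : setT a))) => a b [].
Qed.

Lemma card_le_setT_injects A B : ([set: A] #<= [set: B])%card <-> injects A B.
Proof.
have [A1 A2] := injects_setT A; have [B1 B2] := injects_setT B.
split=> [/card_leP_injects H|H]; last first.
  exact/card_leP_injects/(injects_trans A1)/(injects_trans H).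
exact/(injects_trans A2)/(injects_trans H).
Qed.

(** A maximal partial injection is total or onto. *)
Lemma injects_total (A B : Type) : injects A B \/ injects B A.
Proof.
pose P (G : set (A * B)) :=
  (forall a b b', G (a, b) -> G (a, b') -> b = b') /\
  (forall a a' b, G (a, b) -> G (a', b) -> a = a').
have [|G [[Gf Gi] Gmax]] := @Zorn_bigcup _ P.
  move=> F FP Ftot; split=> [a b b'|a a' b] [X FX XG] [Y FY YG].
    by case: (Ftot X Y FX FY) => XY; [have [+ _] := FP _ FY|have [+ _] := FP _ FX];
      apply; eauto.
  by case: (Ftot X Y FX FY) => XY; [have [_ +] := FP _ FY|have [_ +] := FP _ FX];
    apply; eauto.
have [Gtot|/existsNP[a Ga]] := pselect (forall a, exists b, G (a, b)).
  left; have [f fG] := choice Gtot; exists f => a a' E; apply: (Gi _ _ (f a)) => //.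
  by rewrite E.
have [Gsur|/existsNP[b Gb]] := pselect (forall b, exists a, G (a, b)).
  right; have [f fG] := choice Gsur; exists f => c c' E; apply: (Gf (f c)) => //.
  by rewrite E.
exfalso; apply: (Gmax (G `|` [set (a, b)])).
  split; first by move=> x; left.
  by move=> /(_ (a, b) (or_intror erefl)) Gab; apply: Ga; exists b.
split=> [x y y' [G1|[E1 E2]] [G2|[E3 E4]]|x x' y [G1|[E1 E2]] [G2|[E3 E4]]].
- exact: Gf G1 G2.
- by case: Ga; exists y; rewrite -E3.
- by case: Ga; exists y'; rewrite -E1.
- by rewrite E2 E4.
- exact: Gi G1 G2.
- by case: Gb; exists x; rewrite -E4.
- by case: Gb; exists x'; rewrite -E2.
- by rewrite E1 E3.
Qed.

Lemma square_injects_nat : injects (nat * nat) nat.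
Proof. by exists pickle; exact: pcan_inj (@pickleK _). Qed.

(** Injections [A * A -> A] are encoded as sets of triples, for which the union
    of a chain needs no gluing of functions; [A] is read off the diagonal. *)
Definition square_graph_dom K (G : set (K * K * K)) : set K :=
  [set a | exists c, G (a, a, c)].

Definition square_graph K (G : set (K * K * K)) :=
  [/\ forall a b c, G (a, b, c) ->
        [/\ square_graph_dom G a, square_graph_dom G b & square_graph_dom G c],
      forall a b, square_graph_dom G a -> square_graph_dom G b ->
        exists c, G (a, b, c),
      forall p c c', G (p, c) -> G (p, c') -> c = c' &
      forall p p' c, G (p, c) -> G (p', c) -> p = p'].

Lemma square_graph_fun K (G : set (K * K * K)) : square_graph G ->
  exists2 f : square_graph_dom G * square_graph_dom G -> square_graph_dom G,
    injective f & forall p, G (val p.1, val p.2, val (f p)).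
Proof.
move=> [Gd Gt Gf Gi].
have /choice[f fG] : forall p : square_graph_dom G * square_graph_dom G,
    exists c : square_graph_dom G, G (val p.1, val p.2, val c).
  move=> [a b]; have [c Gc] := Gt _ _ (set_valP a) (set_valP b).
  by have [_ _ Dc] := Gd _ _ _ Gc; exists (SigSub (mem_set Dc)).
exists f => // p q E; have := fG q; rewrite -E => /(Gi _ _ _ (fG p)).
by case: p q {E} => [a b] [a' b'] [] /val_inj -> /val_inj ->.
Qed.

Lemma square_graph_injects K (G : set (K * K * K)) : square_graph G ->
  injects (square_graph_dom G * square_graph_dom G) (square_graph_dom G).
Proof. by move=> /square_graph_fun[f fI _]; exists f. Qed.

Lemma square_graph_of_injection K (Z : Type) (u : Z -> K) (h : Z * Z -> Z) :
  injective u -> injective h ->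
  square_graph [set x | exists p, x = (u p.1, u p.2, u (h p))] /\
  square_graph_dom [set x | exists p, x = (u p.1, u p.2, u (h p))] = range u.
Proof.
move=> uI hI; set G := [set x | _].
have dE : square_graph_dom G = range u.
  apply/seteqP; split=> [a [c [[z z'] [-> _ _]]]|_ [z _ <-]]; first by exists z.
  by exists (u (h (z, z))), (z, z).
split=> //; split; rewrite ?dE.
- by move=> a b c [[z z'] [-> -> ->]]; split; eexists.
- by move=> _ _ [z _ <-] [z' _ <-]; exists (u (h (z, z'))), (z, z').
- move=> _ c c' [[z z'] [-> ->]] [[w w'] [/uI + /uI + ->]].
  by move=> /= -> ->.
- by move=> p p' _ [q [-> ->]] [q' [-> /uI /hI ->]].
Qed.

Lemma injects_refl A : injects A A.
Proof. by exists id. Qed.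

Lemma injects_pair_bool A : injects nat A -> injects (A * A) A ->
  injects (A * bool) A.
Proof.
move=> natA AA; apply: (injects_trans _ AA); apply: injects_prod (injects_refl _) _.
by apply: injects_trans natA; exists nat_of_bool; case; case.
Qed.

Lemma square_graph_chain K (F : set (set (K * K * K))) :
  F `<=` square_graph (K:=K) -> total_on F subset ->
  square_graph (\bigcup_(X in F) X).
Proof.
move=> FP Ftot.
have dS X : F X -> square_graph_dom X `<=` square_graph_dom (\bigcup_(X in F) X).
  by move=> FX a [c Xc]; exists c, X.
have common x y : (\bigcup_(X in F) X) x -> (\bigcup_(X in F) X) y ->
    exists2 X, F X & X x /\ X y.
  move=> [X FX Xx] [Y FY Yy].
  by case: (Ftot X Y FX FY) => XY; [exists Y|exists X] => //; split=> //; exact: XY.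
split.
- move=> a b c [X FX Xabc]; have [Xd _ _ _] := FP _ FX.
  by have [? ? ?] := Xd _ _ _ Xabc; split; exact: (dS _ FX).
- move=> a b [c1 G1] [c2 G2]; have [X FX [X1 X2]] := common _ _ G1 G2.
  have [_ Xt _ _] := FP _ FX.
  have [c Xc] := Xt _ _ (ex_intro _ _ X1) (ex_intro _ _ X2).
  by exists c, X.
- move=> p c c' G1 G2; have [X FX [X1 X2]] := common _ _ G1 G2.
  by have [_ _ Xf _] := FP _ FX; exact: Xf X1 X2.
- move=> p p' c G1 G2; have [X FX [X1 X2]] := common _ _ G1 G2.
  by have [_ _ _ Xi] := FP _ FX; exact: Xi X1 X2.
Qed.

(** A copy of [A], the domain of [G], outside [A] gives a set of size
    [A * bool], whose square minus [A * A] still injects into [A], hence into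
    the copy: the old values are kept and the new ones go to the copy. *)
Lemma square_graph_extend K (G : set (K * K * K)) : square_graph G ->
  injects nat (square_graph_dom G) ->
  injects (square_graph_dom G) (~` square_graph_dom G) ->
  exists G', [/\ square_graph G', injects nat (square_graph_dom G') & G `<` G'].
Proof.
move=> sG natA [h hI]; have AA := square_graph_injects sG.
have [q qI] := injects_trans (injects_prod (injects_pair_bool natA AA)
  (injects_pair_bool natA AA)) AA.
have [Gd Gt Gf Gi] := sG; have [f fI fG] := square_graph_fun sG.
pose u (z : square_graph_dom G * bool) := if z.2 then val (h z.1) else val z.1.
have uI : injective u.
  move=> [a []] [b []]; rewrite /u /=; first by move=> /val_inj /hI ->.
  - by move=> E; case: (set_valP (h a)); rewrite (E : val (h a) = val b); exact: set_valP.
  - by move=> E; case: (set_valP (h b)); rewrite -(E : val a = val (h b)); exact: set_valP.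
  - by move=> /val_inj ->.
pose k (p : (square_graph_dom G * bool) * (square_graph_dom G * bool)) :=
  if p.1.2 || p.2.2 then (q p, true) else (f (p.1.1, p.2.1), false).
have kI : injective k.
  move=> [[a i] [b j]] [[a' i'] [b' j']]; rewrite /k /=.
  case: ifPn => H1; case: ifPn => H2 //.
    by case=> /qI.
  by case=> /fI[-> ->]; case: i j i' j' H1 H2 => [] [] [] [].
have [sG' dG'] := square_graph_of_injection uI kI.
eexists; split; [exact: sG'| |].
- rewrite dG'; apply: injects_trans natA _.
  exists (fun a => SigSub (mem_set (imageT u (a, true)))).
  by move=> a b [/val_inj /hI].
- split=> [[[a b] c] Gabc|GG'].
    have [Da Db Dc] := Gd _ _ _ Gabc.
    exists ((SigSub (mem_set Da), false), (SigSub (mem_set Db), false)).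
    rewrite /u /k /=; congr (_, _, _); apply: Gf Gabc _.
    exact: (fG (SigSub (mem_set Da), SigSub (mem_set Db))).
  have [a0] : inhabited (square_graph_dom G) by case: natA => g _; exact: (inhabits (g 0)).
  apply: (set_valP (h a0)).
  have : square_graph_dom [set x | exists p, x = (u p.1, u p.2, u (k p))] (val (h a0)).
    by rewrite dG'; exists (a0, true).
  by move=> [c /GG' Gc]; exists c.
Qed.

(** An infinite set is as large as its square: a maximal injection
    [A * A -> A] with [A] infinite has a complement too small to contain a copy
    of [A], so the whole type is no larger than [A * bool], that is than [A]. *)
Lemma square_injects K : injects nat K -> injects (K * K) K.
Proof.
move=> [g gI]; have [h hI] := square_injects_nat.
have [s0 d0] := square_graph_of_injection gI hI.
set G0 : set (K * K * K) := [set x | _] in s0 d0.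
pose P (G : set (K * K * K)) :=
  (* the empty set is admitted as the union of the empty chain *)
  square_graph G /\ (G !=set0 -> injects nat (square_graph_dom G)).
have [|G [[sG nG] Gmax]] := @Zorn_bigcup _ P.
  move=> F FP Ftot; split; first by apply: square_graph_chain => // X /FP[].
  move=> [x [X FX Xx]]; have [_ /(_ (ex_intro _ x Xx)) nX] := FP _ FX.
  apply: injects_trans nX (injects_set_type _).
  by move=> a [c Xc]; exists c, X.
have P0 : P G0.
  split=> // _; rewrite d0; exists (fun n => SigSub (mem_set (imageT g n))).
  by move=> m n [/gI].
have {}nG : injects nat (square_graph_dom G).
  apply: nG; apply: contrapT => /set0P/negP/negPn/eqP G_0.
  apply: (Gmax G0) => //; rewrite G_0; split=> // /(_ (g 0, g 0, g (h (0, 0)))).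
  by apply; exists (0, 0).
have AA := square_graph_injects sG.
have [Ext|CA] := injects_total (square_graph_dom G) (~` square_graph_dom G).
  have [G' [sG' nG' GG']] := square_graph_extend sG nG Ext.
  by case: (Gmax G').
have KA : injects K (square_graph_dom G).
  apply: injects_trans (injects_pair_bool nG AA); have [c cI] := CA.
  exists (fun x => match pselect (square_graph_dom G x) with
    | left H => (SigSub (mem_set H), false)
    | right H => (c (SigSub (mem_set (H : (~` square_graph_dom G) x))), true) end).
  move=> x y; case: pselect => Hx; case: pselect => Hy //; first by case.
  by case=> /cI [].
apply: injects_trans (injects_prod KA KA) (injects_trans AA _).
by exists val; exact: val_inj.
Qed.

Lemma injects_seq K : injects nat K -> injects (seq K) K.
Proof.
move=> natK; have [p pI] := square_injects natK; have [g gI] := natK.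
(* equal codes only separate sequences of equal length *)
pose code := foldr (fun x c => p (x, c)) (g 0).
have codeI s t : size s = size t -> code s = code t -> s = t.
  elim: s t => [|x s IHs] [|y t] //= [st] /pI[-> /(IHs _ st) ->] //.
exists (fun s => p (g (size s), code s)) => s t /pI[/gI].
exact: codeI.
Qed.

Lemma injects_countType (A : countType) : injects A nat.
Proof. by exists pickle; exact: pcan_inj (@pickleK _). Qed.

Lemma injects_prod_le A B K : injects nat K ->
  injects A K -> injects B K -> injects (A * B) K.
Proof.
by move=> natK AK BK; exact: injects_trans (injects_prod AK BK) (square_injects natK).
Qed.

Lemma not_injects_powerset K : ~ injects (K -> bool) K.
Proof.
move=> [f fI]; pose d k := `[< exists2 A, f A = k & A k = false >].
case E : (d (f d)).
  by move: (E) => /asboolP[A /fI -> ]; rewrite E.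
by move/asboolPn: (E); apply; exists d.
Qed.

Lemma injects_singletons K : injects K (K -> bool).
Proof.
exists (fun x y => `[< x = y >]) => x y /(congr1 (@^~ y)).
by rewrite [RHS]asboolT // => /asboolP.
Qed.

Lemma injects_antisym A B : injects A B -> injects B A ->
  exists f : A -> B, bijective f.
Proof.
move=> AB BA; have : ([set: A] #= [set: B])%card.
  by rewrite card_eq_le; apply/andP; split; exact/card_le_setT_injects.
move=> /card_bijP[f fB].
have wrapB C : bijective (fun c : C => SigSub (mem_set (I : setT c)) : [set: C]).
  by exists val => // c; exact: val_inj.
have valB C : bijective (val : [set: C] -> C).
  by exists (fun c : C => SigSub (mem_set (I : setT c))) => // c; exact: val_inj.
exists (val \o (f \o (fun a : A => SigSub (mem_set (I : setT a))))).
exact: bij_comp (valB B) (bij_comp fB (wrapB A)).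
Qed.

(** * Initial well-orders and recursion *)

Record strict_well_order T (lt : T -> T -> Prop) : Prop := StrictWellOrder {
  swo_wf : well_founded lt;
  swo_trans : forall x y z, lt x y -> lt y z -> lt x z;
  swo_total : forall x y, [\/ lt x y, x = y | lt y x] }.

Lemma strict_well_order_exists (T : Type) :
  exists lt : T -> T -> Prop, strict_well_order lt.
Proof.
elim/Peq : T => T; have [R Rwo] := wochoice.well_ordering_principle T.
have Rmin (P : set T) x : P x -> exists2 z, P z & forall y, P y -> R z y.
  move=> Px; have [|z [[Pz zP] _]] := Rwo (fun x => `[< P x >]).
    by exists x; exact/asboolP.
  by exists z; [exact/asboolP|move=> y Py; apply: zP; exact/asboolP].
have Rtot x y : R x y \/ R y x.
  have [z [] -> H] := Rmin [set x; y] x (or_introl erefl).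
    by left; apply: H; right.
  by right; apply: H; left.
have Rxx x : R x x by case: (Rtot x x).
have Ranti x y : R x y -> R y x -> x = y.
  move=> Rxy Ryx; have [|z [_ zP]] := Rwo [pred w | (w == x) || (w == y)].
    by exists x; rewrite !inE eqxx.
  rewrite -(zP x); last first.
    by split=> [|w]; rewrite !inE ?eqxx // => /orP[] /eqP ->.
  rewrite -(zP y) //.
  by split=> [|w]; rewrite !inE ?eqxx ?orbT // => /orP[] /eqP ->.
have Rtr x y z : R x y -> R y z -> R x z.
  move=> Rxy Ryz.
  have [w + H] := Rmin [set w | [\/ w = x, w = y | w = z]] x (Or31 _ _ erefl).
  have Hx := H x (Or31 _ _ erefl); have Hy := H y (Or32 _ _ erefl).
  have Hz := H z (Or33 _ _ erefl).
  move=> []?; subst w => //; first by rewrite (Ranti x y).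
  by rewrite -(Ranti y z).
exists (fun x y => ~ R y x); split.
- move=> x; apply: contrapT => nAx.
  have [z nAz zP] := Rmin (fun x => ~ Acc (fun x y => ~ R y x) x) x nAx.
  by apply: nAz; split=> y nRzy; apply: contrapT => /zP.
- move=> x y z nyx nzy Rzx; have [Rxy|//] := Rtot x y.
  by apply: nzy; exact: Rtr Rzx Rxy.
- move=> x y; have [Rxy|] := pselect (R x y); last by constructor 3.
  have [Ryx|] := pselect (R y x); last by constructor 1.
  by constructor 2; exact: Ranti.
Qed.

(** The order type is an initial ordinal: either a well-order of [L] already has
    small initial segments, or its least large initial segment has. *)
Lemma initial_well_order (L : Type) :
  exists (T : Type) (lt : T -> T -> Prop) (e : T -> L),
    [/\ strict_well_order lt, forall a, exists t, e t = a &
        forall t, ~ injects L {s | lt s t}].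
Proof.
have [lt [lt_wf lt_tr lt_tot]] := strict_well_order_exists L.
have [small|/existsNP[t /contrapT]] := pselect (forall t, ~ injects L {s | lt s t}).
  by exists L, lt, id; split=> // a; exists a.
elim/(well_founded_ind lt_wf): t => t IHt tbig.
have [[s st sbig]|small] := pselect (exists2 s, lt s t & injects L {r | lt r s}).
  exact: IHt sbig.
have [h hI] := tbig.
have [[a0]|Lempty] := pselect (inhabited L); last first.
  by exists L, lt, id; split=> // a; [exists a|case: Lempty].
pose e (s : {s | lt s t}) : L :=
  if pselect (exists a, h a = s) is left H then sval (cid H) else a0.
exists {s | lt s t}, (fun r s => lt (sval r) (sval s)), e; split.
- split.
  + move=> [s st]; elim/(well_founded_ind lt_wf): s st => s IHs st.
    by split=> -[r rt] rs; exact: IHs.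
  + by move=> ? ? ?; exact: lt_tr.
  + move=> [x xt] [y yt]; case: (lt_tot x y) => H; first by constructor 1.
      by constructor 2; exact: eq_exist.
    by constructor 3.
- move=> a; exists (h a); rewrite /e; case: pselect => [H|]; last by case; exists a.
  by apply: hI; exact: (svalP (cid H)).
- move=> [s st] sbig; apply: small; exists s => //; apply: injects_trans sbig _.
  exists (fun r : {r : {r | lt r t} | lt (sval r) s} =>
    exist (fun x => lt x s) (sval (sval r)) (svalP r)).
  by move=> [[x xt] xs] [[y yt] ys] [/= xy]; apply/eq_exist/eq_exist.
Qed.

(** Recursion with a choice at each stage; the last hypothesis says that the
    requirement [P t f o] depends on [f] below [t] only. *)
Lemma wf_choice T (lt : T -> T -> Prop) O (o0 : O) (P : T -> (T -> O) -> O -> Prop) :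
  well_founded lt -> (forall t f, exists o, P t f o) ->
  (forall t f g o, (forall s, lt s t -> f s = g s) -> P t f o -> P t g o) ->
  exists f, forall t, P t f (f t).
Proof.
move=> wf Pex Pext.
have [c cP] := choice (fun tf : T * (T -> O) => Pex tf.1 tf.2).
pose below t (rec : forall s, lt s t -> O) s :=
  if pselect (lt s t) is left H then rec s H else o0.
pose F t rec := c (t, below t rec).
exists (Fix wf (fun=> O) F) => t.
rewrite Init.Wf.Fix_eq; last first.
  move=> x f g fg; congr (F x _); apply/functional_extensionality_dep => s.
  exact/functional_extensionality_dep.
apply: Pext (cP (t, _)) => s st /=; rewrite /below.
by case: pselect.
Qed.

(** Otherwise [a] is determined by a stage [s] before [t] at which it is used
    and by its index in [G s], so [L] would be countable or no larger than the
    initial segment below [t]. *)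
Lemma initial_well_order_fresh (L : eqType) (T : Type) (lt : T -> T -> Prop) :
  ~ injects L nat -> (forall t, ~ injects L {s | lt s t}) ->
  forall t (G : T -> seq L), exists a, forall s, lt s t -> a \notin G s.
Proof.
move=> Lunc small t G; apply: contrapT => nofresh.
have /choice[c cP] a : exists s : {s | lt s t}, a \in G (sval s).
  apply: contrapT => H; apply: nofresh; exists a => s st.
  by apply/negP => aG; apply: H; exists (exist _ s st).
have LN : injects L ({s | lt s t} * nat).
  exists (fun a => (c a, index a (G (sval (c a))))) => a b [cab iab].
  rewrite -(nth_index a (cP a)) iab -cab nth_index //.
  by rewrite cab; exact: cP.
have [Nseg|segN] := injects_total nat {s | lt s t}.
  apply: (small t); apply: injects_trans LN _.
  exact: (injects_prod_le Nseg (injects_refl _) Nseg).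
apply: Lunc; apply: injects_trans LN _.
exact: (injects_prod_le (injects_refl _) segN (injects_refl _)).
Qed.

(** * Spaces forced by a tree of dense sets *)

Lemma nowhere_denseS (T : topologicalType) (A B : set T) :
  A `<=` B -> nowhere_dense B -> nowhere_dense A.
Proof.
by move=> /closureS/interiorS + nB; rewrite /nowhere_dense -subset0 -nB.
Qed.

Lemma dense_in_open_somewhere_dense (T : topologicalType) (U D A : set T) :
  open U -> U !=set0 -> dense D -> U `&` D `<=` A -> ~ nowhere_dense A.
Proof.
move=> oU [x Ux] dD UDA nA; rewrite -[False]/(set0 x) -nA.
rewrite /interior/=; apply: filterS (open_nbhs_nbhs (conj oU Ux)) => y Uy V.
rewrite nbhsE => -[W [oW Wy] WV].
have [z [[Uz Wz] Dz]] := dD (U `&` W) (ex_intro _ y (conj Uy Wy)) (openI oU oW).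
by exists z; split; [exact: UDA|exact: WV].
Qed.

Lemma resolvable_family (K : Type) (T : topologicalType) (E : K -> set T) :
  [set: T] !=set0 -> (forall i, dense (E i)) ->
  (forall i j, i <> j -> E i `&` E j = set0) -> resolvable K T.
Proof.
move=> T0 dE disj.
have EI : injective E.
  move=> i j Eij; apply: contrapT => /disj; rewrite Eij setIid => Ej0.
  by have [x [_]] := dE j setT T0 openT; rewrite Ej0.
exists (range E); split.
- by apply: inj_card_eq => i j _ _; exact: EI.
- by move=> _ [i _ <-].
- move=> _ _ [i _ <-] [j _ <-] Eij; apply: disj => ij.
  by apply: Eij; rewrite ij.
Qed.

Record tree_forced (K : Type) (T : topologicalType) (D : seq K -> set T) : Prop :=
  TreeForced {
    tree_dense : forall s, dense (D s);
    tree_sub : forall s i, D (rcons s i) `<=` D s;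
    tree_disj : forall s i j, i <> j -> D (rcons s i) `&` D (rcons s j) = set0;
    tree_dichotomy : forall A : set T, (nowhere_dense A /\ closed A) \/
      exists U s, [/\ open U, U !=set0 & U `&` D s `<=` A] }.

Lemma tree_forced_nodec K (T : topologicalType) (D : seq K -> set T) :
  tree_forced D -> nodec T.
Proof.
move=> [dD _ _ dich] A nA; have [[]//|[U [s [oU U0 UA]]]] := dich A.
by case: (dense_in_open_somewhere_dense oU U0 (dD s) UA).
Qed.

Lemma tree_forced_open_card K (T : topologicalType) (D : seq K -> set T) U s :
  tree_forced D -> open U -> U !=set0 -> injects K (U `&` D s : set T).
Proof.
move=> [dD subD disD _] oU U0.
have /choice[f fP] i := dD (rcons s i) U U0 oU.
have fD i : (U `&` D s) (f i) by have [Uf Df] := fP i; split=> //; exact: subD Df.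
exists (fun i => SigSub (mem_set (fD i))) => i j [E]; apply: contrapT => /(disD s).
move=> /seteqP[/(_ (f i)) + _]; apply; have [_ Di] := fP i; have [_ Dj] := fP j.
by split=> //; rewrite E.
Qed.

Lemma tree_forced_card K (T : topologicalType) (D : seq K -> set T) :
  tree_forced D -> [set: T] !=set0 -> injects T K ->
  ([set: T] #= [set: K])%card.
Proof.
move=> tD T0 TK; rewrite card_eq_le; apply/andP; split; first by apply/card_le_setT_injects.
have KT := tree_forced_open_card [::] tD openT T0.
apply/card_le_setT_injects/(injects_trans KT).
by exists val; exact: val_inj.
Qed.

Lemma tree_forced_dispersion K (T : topologicalType) (D : seq K -> set T) :
  tree_forced D -> [set: T] !=set0 -> injects T K -> is_dispersion_character T K.
Proof.
move=> tD T0 TK; split.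
  by exists setT; [split=> //; exact: openT|exact: tree_forced_card tD T0 TK].
move=> U [oU U0]; apply/card_leP_injects/(injects_trans (injects_setT K).1).
apply: injects_trans (tree_forced_open_card [::] tD oU U0) (injects_set_type _).
by move=> x [].
Qed.

Lemma tree_forced_nwd K (T : topologicalType) (D : seq K -> set T) :
  tree_forced D -> [set: T] !=set0 -> injects T K -> is_nwd T K.
Proof.
move=> tD T0 TK; split.
  exists setT; last exact: tree_forced_card tD T0 TK.
  apply: (dense_in_open_somewhere_dense openT T0 (tree_dense tD [::])).
  exact: subsetT.
move=> A nA; have [[]//|[U [s [oU U0 UA]]]] := tree_dichotomy tD A.
apply/card_leP_injects/(injects_trans (injects_setT K).1).
by apply: injects_trans (tree_forced_open_card s tD oU U0) (injects_set_type _).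
Qed.

Lemma tree_forced_resolvable K (T : topologicalType) (D : seq K -> set T) :
  tree_forced D -> [set: T] !=set0 -> resolvable K T.
Proof.
move=> tD T0; apply: (resolvable_family (E := fun i => D (rcons [::] i)) T0).
  by move=> i; exact: tree_dense.
by move=> i j; exact: tree_disj.
Qed.

Lemma dispersion_character_injects (T : topologicalType) K K' :
  is_dispersion_character T K -> is_dispersion_character T K' -> injects K K'.
Proof.
move=> [_ minK] [[A PA AK'] _]; apply/card_le_setT_injects/(card_le_trans (minK A PA)).
by move/card_eqPle: AK' => [].
Qed.

(** Each dense set [A] of the family contains some [U `&` D s]; a point of [U]
    together with [s] determines [A], since dense sets sharing both have a
    somewhere dense intersection. So the family injects into [T * seq K]. *)
Lemma tree_forced_not_extraresolvable K (T : topologicalType) (D : seq K -> set T) :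
  injects nat K -> tree_forced D -> [set: T] !=set0 -> injects T K ->
  ~ extraresolvable T.
Proof.
move=> natK tD T0 TK [K' [L [dK' [[_ nLK'] _] [F [FL dF nF]]]]].
apply/nLK'/card_le_setT_injects.
have {dK'} := dispersion_character_injects (tree_forced_dispersion tD T0 TK) dK'.
apply: injects_trans; apply: injects_trans (injects_prod_le natK TK (injects_seq natK)).
have LF : injects L F.
  move/card_eqPle: FL => [_ /card_leP_injects]; apply: injects_trans.
  exact: (injects_setT L).2.
apply: injects_trans LF _.
have /choice[c cP] (A : F) : exists c : T * seq K,
    exists U, [/\ open U, U c.1 & U `&` D c.2 `<=` val A].
  have [[nA _]|[U [s [oU [x Ux] UA]]]] := tree_dichotomy tD (val A).
    have := dense_in_open_somewhere_dense openT T0 (dF _ (set_valP A)).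
    by move=> /(_ (val A)) []// x [].
  by exists (x, s), U.
exists c => A B cAB; apply: val_inj; apply: contrapT => AB.
have [U [oU Ux UA]] := cP A; have [V [oV Vx VB]] := cP B.
have := nF _ _ (set_valP A) (set_valP B) AB.
rewrite -cAB in Vx VB.
apply: (dense_in_open_somewhere_dense (openI oU oV) _ (tree_dense tD (c A).2)).
  by exists (c A).1.
by move=> x [[Ux' Vx'] Dx]; split; [exact: UA|exact: VB].
Qed.

(** If [O `&` Y] were nowhere dense then so would be [(O `&` Y) `\ y] for [y] in
    it; that set would be closed, and [y] would be isolated in [Y]. *)
Lemma tree_forced_crowded_somewhere_dense K (T : topologicalType) (D : seq K -> set T)
  (Y O : set T) : tree_forced D -> crowded (set_type Y) -> open O ->
  O `&` Y !=set0 -> ~ nowhere_dense (O `&` Y).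
Proof.
move=> tD crY oO [y [Oy Yy]] nOY.
suff : isolated [set: set_type Y] (SigSub (mem_set Yy)) by rewrite crY.
split; first exact: mem_set.
exists (val @^-1` (O `&` ~` ((O `&` Y) `\ y))).
  apply: open_nbhs_nbhs; split; last by split=> // -[_ /(_ erefl)].
  exists (O `&` ~` ((O `&` Y) `\ y)) => //; apply: openI => //.
  apply: closed_openC; apply: (tree_forced_nodec tD).
  by apply: nowhere_denseS nOY => x [].
rewrite setIT; apply/seteqP; split=> [z [Oz nz]|_ -> /=]; last by split=> // -[_ /(_ erefl)].
apply: val_inj => /=; apply: contrapT => zy; apply: nz; split=> //.
by split=> //; exact: set_valP.
Qed.

(** The dense sets are assembled over a maximal disjoint family [M] of open sets
    [U] with [U `&` D s `<=` Y]: the [i]-th one takes [U `&` D (rcons s i)] in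
    each member of [M]. An open set that meets [Y] and misses the [i]-th dense
    set would contain a further member, contradicting maximality. *)
Lemma tree_forced_hereditarily_resolvable K (T : topologicalType) (D : seq K -> set T) :
  tree_forced D -> hereditarily_resolvable K T.
Proof.
move=> tD Y [y0 Yy0] crY.
pose good : set (set T * seq K) :=
  [set Us | [/\ open Us.1, Us.1 !=set0 & Us.1 `&` D Us.2 `<=` Y]].
have [M [Mgood Mtriv Mmax]] := ex_maximal_disjoint_subcollection fst good.
pose E i : set T := \bigcup_(Us in M) (Us.1 `&` D (rcons Us.2 i)).
have EY i : E i `<=` Y.
  move=> x [Us /Mgood[_ _ UsY] [Ux Dx]]; apply: UsY; split=> //.
  exact: tree_sub tD _ _ _ Dx.
have Edisj i j : i <> j -> E i `&` E j = set0.
  move=> ij; apply/seteqP; split=> // x [[Us MUs [Ux Dx]] [Vr MVr [Vx Dx']]].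
  have UV : Us = Vr by apply: Mtriv => //; exists x.
  by rewrite -UV in Dx'; rewrite -(tree_disj tD Us.2 ij).
have Edense i O : open O -> O `&` Y !=set0 -> O `&` E i !=set0.
  move=> oO OY; apply: contrapT => OE.
  have := tree_forced_crowded_somewhere_dense tD crY oO OY.
  have [[]//|[U [s [oU U0 UOY]]] _] := tree_dichotomy tD (O `&` Y).
  have [z [Uz Dz]] := tree_dense tD s U0 oU.
  pose W := (U `&` O, s).
  have oUO : open (U `&` O) by exact: openI.
  have UO0 : U `&` O !=set0 by exists z; split=> //; have [] := UOY z (conj Uz Dz).
  have goodW : good W by split=> // x [[Ux _] Dx]; have [] := UOY x (conj Ux Dx).
  have WM Vr : M Vr -> Vr.1 `&` W.1 = set0.
    move=> MVr; apply/eqP/negPn/negP => /set0P VW0; apply: OE.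
    have [oV _ _] := Mgood _ MVr.
    have [x [[Vx [_ Ox]] Dx]] :=
      tree_dense tD (rcons Vr.2 i) VW0 (openI oV oUO).
    by exists x; split=> //; exists Vr.
  apply: (Mmax (M `|` [set W])).
  - split; first by move=> x; left.
    move=> /(_ W (or_intror erefl)) /WM; rewrite setIid => W0.
    by move: UO0; rewrite -[U `&` O]/W.1 W0 => -[].
  - by move=> Us [/Mgood//|->].
  - move=> Us Vr [MUs|->] [MVr|->] //; first exact: Mtriv.
      by rewrite (WM Us) // => -[].
    by rewrite setIC (WM Vr) // => -[].
apply: (resolvable_family (E := fun i => val @^-1` (E i) : set (set_type Y))).
- by exists (SigSub (mem_set Yy0)).
- move=> i V [[y Yy] yO] [O oO Oe].
  have [|x [Ox Ex]] := Edense i O oO.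
    by exists y; split; [rewrite -Oe in yO|exact: set_mem].
  by exists (SigSub (mem_set (EY i x Ex))); split=> //; rewrite -Oe.
- move=> i j /Edisj Eij; apply/seteqP; split=> // x [Ei Ej].
  by have : (E i `&` E j) (val x) by []; rewrite Eij.
Qed.

(** * The transfinite recursion *)

Definition agree (L : eqType) (c : seq L) (u v : L -> bool) :=
  forall i, i \in c -> u i = v i.

(** The code after the stages in [J]: the outcome [f s] of stage [s] is the list
    of blocks used there, with a flag telling whether they were sacrificed to
    [e s] (every value of a point of [e s] in them becomes [false]) or frozen. *)
Definition erase_at (S T : Type) (L : eqType) (base : S -> L * nat -> bool)
    (e : T -> set S) (f : T -> seq L * bool) (J : set T) (p : S) (i : L * nat) :=
  base p i && ~~ `[< exists s, [/\ J s, (f s).2, i.1 \in (f s).1 & e s p] >].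

Lemma erase_at_eq (S T : Type) (L : eqType) (base : S -> L * nat -> bool)
    (e : T -> set S) (f : T -> seq L * bool) (J : set T) p i :
  (forall s, (f s).2 -> i.1 \in (f s).1 -> e s p -> J s) ->
  erase_at base e f setT p i = erase_at base e f J p i.
Proof.
move=> H; rewrite /erase_at; congr (_ && ~~ _); apply: asbool_equiv_eq.
by split=> -[s [Js fs im es]]; exists s; split=> //; exact: H.
Qed.

(** The finitely many coordinates in [c] are affected by finitely many stages,
    one at most for each coordinate, so that a last one exists. *)
Lemma last_stage (T : Type) (lt : T -> T -> Prop) (L : eqType) (Q : T -> L -> Prop) :
  strict_well_order lt -> (forall s t i, Q s i -> Q t i -> s = t) ->
  forall c : seq L, (forall i s, i \in c -> ~ Q s i) \/
    exists t, (exists2 i, i \in c & Q t i) /\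
      forall s i, i \in c -> Q s i -> s = t \/ lt s t.
Proof.
move=> [_ ltr ltot] Quniq; elim=> [|i c IHc]; first by left.
have [[s Qsi]|nQ] := pselect (exists s, Q s i); last first.
  case: IHc => [H|[t [[j jc Qtj] H]]].
    by left=> j s; rewrite inE => /orP[/eqP -> Q'|/H //]; apply: nQ; exists s.
  right; exists t; split; first by exists j; rewrite // inE jc orbT.
  by move=> s k; rewrite inE => /orP[/eqP -> Q'|/H]; [case: nQ; exists s|exact].
case: IHc => [H|[t [[j jc Qtj] H]]].
  right; exists s; split; first by exists i; rewrite // mem_head.
  move=> r k; rewrite inE => /orP[/eqP -> Q'|/H]; last by move=> /[apply].
  by left; exact: Quniq Q' Qsi.
have [st|ts] : lt t s \/ (s = t \/ lt s t).
  by have [||] := ltot s t; auto.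
- right; exists s; split; first by exists i; rewrite // mem_head.
  move=> r k; rewrite inE => /orP[/eqP -> Q'|kc Q'].
    by left; exact: Quniq Q' Qsi.
  by right; have [->//|rt] := H _ _ kc Q'; exact: ltr rt st.
- right; exists t; split; first by exists j; rewrite // inE jc orbT.
  move=> r k; rewrite inE => /orP[/eqP -> Q'|kc Q']; last exact: H kc Q'.
  by rewrite (Quniq _ _ _ Q' Qsi).
Qed.

(** A cylinder of the final code that meets some sacrificed block is a cylinder
    of the code just before the last stage [t] concerned, and points outside
    [e t] are unaffected by that stage: so it suffices that a block is
    sacrificed only when each cylinder has points of each [D s] outside [e t].
    Otherwise some trace of a cylinder on [D s] lies in [e t]; freezing the
    blocks of that cylinder keeps it unchanged until the end. *)
Lemma forced_code (S T I : Type) (L : choiceType) (lt : T -> T -> Prop)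
    (e : T -> set S) (D : I -> set S) (base : S -> L * nat -> bool) :
  strict_well_order lt -> (forall A, exists t, e t = A) ->
  (forall t (G : T -> seq L), exists a, forall s, lt s t -> a \notin G s) ->
  (forall c v s, exists2 p, D s p & agree c (base p) v) ->
  (forall p a, exists n, base p (a, n)) ->
  exists C : S -> L * nat -> bool,
    (forall c v s, exists2 p, D s p & agree c (C p) v) /\
    forall A : set S,
      (exists a, (forall p n, A p -> ~~ C p (a, n)) /\
                 (forall p, ~ A p -> exists n, C p (a, n))) \/
      (exists c v s, forall p, D s p -> agree c (C p) v -> A p).
Proof.
move=> wo esur fresh base_dense base_cover; have [lt_wf lt_tr lt_tot] := wo.
pose P t f (o : seq L * bool) :=
  (exists c v s, (forall p, D s p -> agree c (erase_at base e f (lt^~ t) p) v -> e t p)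
     /\ o = ([seq i.1 | i <- c], false)) \/
  ((forall c v s, exists p, [/\ D s p,
      agree c (erase_at base e f (lt^~ t) p) v & ~ e t p]) /\
   exists a, (forall s, lt s t -> a \notin (f s).1) /\ o = ([:: a], true)).
have [||f fP] := @wf_choice T lt _ ([::], false) P lt_wf.
- move=> t f; have [[c [v [s H]]]|H] := pselect (exists c v s, forall p, D s p ->
    agree c (erase_at base e f (lt^~ t) p) v -> e t p).
    by exists ([seq i.1 | i <- c], false); left; exists c, v, s.
  have [a afresh] := fresh t (fun s => (f s).1).
  exists ([:: a], true); right; split; last by exists a.
  move=> c v s; apply: contrapT => H'; apply: H; exists c, v, s => p Dp cp.
  by apply: contrapT => nep; apply: H'; exists p.
- move=> t f g o fg.
  have -> : P t f o = P t g o; last by [].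
  rewrite /P.
  have -> : erase_at base e f (lt^~ t) = erase_at base e g (lt^~ t).
    apply/funext => p; apply/funext => i; congr (_ && ~~ _); apply: asbool_equiv_eq.
    by split=> -[s [st]]; [rewrite fg//|rewrite -fg//]; exists s; split.
  have -> // : (fun a => (forall s, lt s t -> a \notin (f s).1) /\ o = ([:: a], true)) =
     (fun a => (forall s, lt s t -> a \notin (g s).1) /\ o = ([:: a], true)).
  apply/funext => a; apply/propext; split=> -[H ->]; split=> // s st.
    by rewrite -fg//; exact: H.
  by rewrite fg//; exact: H.
have flagged t : (f t).2 ->
    (forall c v s, exists p, [/\ D s p,
      agree c (erase_at base e f (lt^~ t) p) v & ~ e t p]) /\
    exists a, (forall s, lt s t -> a \notin (f s).1) /\ f t = ([:: a], true).
  by case: (fP t) => // -[c [v [s [_ ->]]]].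
have no_later s t a : (f t).2 -> lt s t -> a \in (f t).1 -> a \notin (f s).1.
  by move=> /flagged[_ [b [bfresh ->]]] st; rewrite inE => /eqP ->; exact: bfresh.
have once s t (a : L) : (f s).2 /\ a \in (f s).1 -> (f t).2 /\ a \in (f t).1 -> s = t.
  move=> [fs as_] [ft at_]; have [st|//|ts] := lt_tot s t.
    by have := no_later _ _ _ ft st at_; rewrite as_.
  by have := no_later _ _ _ fs ts as_; rewrite at_.
exists (erase_at base e f setT); split=> [c v s|A].
  have [|none|[t [[i ic [ft it]] tmax]]] := @last_stage T lt _
      (fun s (i : L * nat) => (f s).2 /\ i.1 \in (f s).1) wo _ c.
  - by move=> ? ? i; exact: once.
  - have [p Dp cp] := base_dense c v s; exists p => // i ic; rewrite -cp //.
    rewrite /erase_at; case: asboolP; rewrite ?andbT // => -[r [_ fr ir _]].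
    by case: (none i r ic).
  - have [/(_ c v s)[p [Dp cp nep]] _] := flagged t ft.
    exists p => // j jc; rewrite -cp //; apply: erase_at_eq => r fr jr er.
    by case: (tmax r j jc (conj fr jr)) => // rt; rewrite rt in er.
have [t <-] := esur A.
have [[c [v [s [H ft]]]]|[_ [a [afresh ft]]]] := fP t; [right|left].
  exists c, v, s => p Dp cp; apply: H => // i ic; rewrite -cp //.
  apply/esym/erase_at_eq => r fr ir er.
  have it : i.1 \in (f t).1 by rewrite ft; exact: map_f.
  have [//|rt|tr] := lt_tot r t; first by rewrite rt ft in fr.
  by have := no_later _ _ _ fr tr ir; rewrite it.
have at_ : a \in (f t).1 by rewrite ft mem_head.
have fl : (f t).2 by rewrite ft.
exists a; split=> [p n ep|p nep].
  by rewrite /erase_at negb_and negbK; apply/orP; right; apply/asboolP; exists t.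
have [n bn] := base_cover p a; exists n; rewrite /erase_at bn /=.
apply/asboolPn => -[s [_ fs as_ es]].
by rewrite (once _ _ _ (conj fs as_) (conj fl at_)) in es.
Qed.

(** * The initial independent code *)

(** A point consists of a finite set of test points of [K], a finite list of
    accepted pairs (trace on the test points, index), a bound and a node of the
    tree. The first two components are those of the classical dense subset of
    size [K] in the cube of weight [K -> bool]. *)
Definition point (K : Type) : Type := (seq K * seq (seq bool * nat) * nat * seq K)%type.

(** Indices past the bound of a point get the value [true], so that each point
    has the value [true] somewhere in each block: this is what will make the
    complement of a set with a sacrificed block open. *)
Definition base_code (K : Type) (p : point K) (i : (K -> bool) * nat) : bool :=
  (p.1.2 <= i.2)%N || ((map i.1 p.1.1.1, i.2) \in p.1.1.2).

Definition node_set (K : Type) (s : seq K) : set (point K) :=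
  [set p | exists w, p.2 = s ++ w].

Lemma injects_point K : injects nat K -> injects (point K) K.
Proof.
move=> natK; have seqK := injects_seq natK.
have ctK (A : countType) : injects A K := injects_trans (injects_countType A) natK.
do 3![apply: (injects_prod_le natK) => //]; exact: ctK.
Qed.

Lemma node_set_sub K (s : seq K) i : node_set (rcons s i) `<=` node_set s.
Proof. by move=> p [w E]; exists (i :: w); rewrite E cat_rcons. Qed.

Lemma node_set_disj K (s : seq K) i j :
  i <> j -> node_set (rcons s i) `&` node_set (rcons s j) = set0.
Proof.
move=> ij; apply/seteqP; split=> // p [[w E] [w']].
rewrite {}E !cat_rcons => E; case: ij.
by elim: s E => [[]|x s IHs [/IHs]].
Qed.

Lemma separating_list (K : Type) (k0 : K) (l : seq (K -> bool)) :
  exists F : seq K, forall Y Y', Y \in l -> Y' \in l -> map Y F = map Y' F -> Y = Y'.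
Proof.
have /choice[d dP] (YZ : (K -> bool) * (K -> bool)) :
    exists k, YZ.1 k = YZ.2 k -> YZ.1 = YZ.2.
  apply: contrapT => H; have Hk k : YZ.1 k = YZ.2 k.
    by apply: contrapT => nk; apply: H; exists k.
  by apply: H; exists k0 => _; exact/funext.
elim/Pchoice: K => K in k0 l d dP *.
exists [seq d (Y, Z) | Y <- l, Z <- l] => Y Z Yl Zl /eq_in_map E.
by apply: (dP (Y, Z)); apply: E; exact: allpairs_f.
Qed.

(** Test points separating the subsets of [K] that occur in [c], and a bound
    above the indices that occur in [c], leave the choice of the accepted pairs
    free. *)
Lemma base_code_dense (K : Type) (k0 : K) (c : seq ((K -> bool) * nat)) v (s : seq K) :
  exists2 p, node_set s p & agree c (base_code p) v.
Proof.
have [F Fsep] := separating_list k0 (map fst c).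
exists (F, [seq (map i.1 F, i.2) | i <- c & v i], (sumn (map snd c)).+1, s).
  by exists [::]; rewrite cats0.
move=> i ic; rewrite /base_code /= leqNgt ltnS.
have -> : i.2 <= sumn (map snd c).
  elim: c ic {Fsep} => //= j c IHc; rewrite inE => /orP[/eqP ->|/IHc ic].
    exact: leq_addr.
  by rewrite (leq_trans ic) // leq_addl.
apply/mapP/idP => [[j]|vi]; last by exists i; rewrite // mem_filter vi.
rewrite mem_filter => /andP[vj jc] [E1 E2].
have -> // : i = j.
rewrite [i]surjective_pairing [j]surjective_pairing E2; congr pair.
by apply: Fsep E1; exact: map_f.
Qed.

Lemma base_code_cover K (p : point K) a : exists n, base_code p (a, n).
Proof. by exists p.1.2; rewrite /base_code leqnn. Qed.

(** The stages enumerate [K -> bool], which maps onto the subsets of [point K]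
    along an injection of [point K] into [K]. *)
Lemma forced_code_exists (K : Type) : injects nat K ->
  exists C : point K -> (K -> bool) * nat -> bool,
    (forall c v s, exists2 p, node_set s p & agree c (C p) v) /\
    forall A : set (point K),
      (exists a, (forall p n, A p -> ~~ C p (a, n)) /\
                 (forall p, ~ A p -> exists n, C p (a, n))) \/
      (exists c v s, forall p, node_set s p -> agree c (C p) v -> A p).
Proof.
move=> natK; have [j jI] := injects_point natK.
have [T [lt [e [wo esur small]]]] := initial_well_order (K -> bool).
apply: (forced_code (e := fun t => [set p | e t (j p)]) wo).
- move=> A; have [t et] := esur (fun k => `[< exists2 p, A p & j p = k >]).
  exists t; rewrite et; apply/seteqP; split=> p /=; last by move=> Ap; apply/asboolP; exists p.
  by move=> /asboolP[q Aq /jI <-].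
- apply: initial_well_order_fresh small => Lnat.
  exact: not_injects_powerset (injects_trans Lnat natK).
- by have [g _] := natK; exact: base_code_dense (g 0).
- exact: base_code_cover.
Qed.

(** * The subspace of the cube *)

Lemma cube_cylinder (L : choiceType) (O : set (prod_topology (fun _ : L => bool)))
    (y : L -> bool) :
  open O -> O y -> exists l : seq L, forall z, (forall i, i \in l -> z i = y i) -> O z.
Proof.
move=> oO Oy.
pose F : set_system (prod_topology (fun _ : L => bool)) :=
  [set A | exists l : seq L, forall z, (forall i, i \in l -> z i = y i) -> A z].
have FF : Filter F.
  split.
  - by exists [::].
  - move=> P Q [l lP] [m mQ]; exists (l ++ m) => z zy; split.
      by apply: lP => i il; apply: zy; rewrite mem_cat il.
    by apply: mQ => i im; apply: zy; rewrite mem_cat im orbT.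
  - by move=> P Q PQ [l lP]; exists l => z /lP /PQ.
have Fy : F --> (y : prod_topology (fun _ : L => bool)).
  apply/cvg_sup => i A [_ [[B oB <-] By] BA].
  by exists [:: i] => z zy; apply: BA; rewrite /= zy ?mem_head.
by apply: Fy; exact: open_nbhs_nbhs.
Qed.

Lemma cube_open_coordinate (L : choiceType) (i : L) (b : bool) :
  open [set z : prod_topology (fun _ : L => bool) | z i = b].
Proof.
rewrite openE => z zb; pose cube : topologicalType := prod_topology (fun _ : L => bool).
have /cvg_sup/(_ i) zz : nbhs (z : cube) --> (z : cube) by exact: cvg_id.
apply: zz; apply: open_nbhs_nbhs; split=> //.
by exists [set b] => //; exact: discrete_open.
Qed.

(** [tree_forced] for the space of codes, expressed on the points; [J]
    enumerates the coordinates of a block sacrificed to [A]. *)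
Record tree_forced_code (K S : Type) (L : eqType) (D : seq K -> set S)
    (code : S -> L -> bool) : Prop := TreeForcedCode {
  code_dense : forall c v s, exists2 p, D s p & agree c (code p) v;
  code_sub : forall s i, D (rcons s i) `<=` D s;
  code_disj : forall s i j, i <> j -> D (rcons s i) `&` D (rcons s j) = set0;
  code_dichotomy : forall A : set S,
    (exists J : nat -> L, [/\ forall c : seq L, exists n, J n \notin c,
        forall p n, A p -> ~~ code p (J n) &
        forall p, ~ A p -> exists n, code p (J n)]) \/
    (exists c v s, forall p, D s p -> agree c (code p) v -> A p) }.

(** There are as many coordinates [(block, index)] as blocks, so that the codes
    can be read along a bijection as points of the cube. *)
Lemma tree_forced_code_exists (K : Type) : injects nat K ->
  exists code : point K -> (K -> bool) -> bool,
    tree_forced_code (@node_set K) code.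
Proof.
move=> natK; have [C [Cdense Cdich]] := forced_code_exists natK.
have natL : injects nat (K -> bool) by exact: injects_trans natK (injects_singletons K).
have [||dec [enc decK encK]] := @injects_antisym (K -> bool) ((K -> bool) * nat).
- by exists (fun Y => (Y, 0)) => Y Z [].
- exact: (injects_prod_le natL (injects_refl _) natL).
have trans c v p :
    agree [seq dec i | i <- c] (C p) (v \o enc) <-> agree c (fun i => C p (dec i)) v.
  split=> H i; first by move=> ic; rewrite H ?map_f //= decK.
  by move=> /mapP[k kc ->]; rewrite /= H // decK.
exists (fun p i => C p (dec i)); split.
- move=> c v s; have [p Dp cp] := Cdense [seq dec i | i <- c] (v \o enc) s.
  by exists p => //; exact/trans.
- by move=> s i; exact: node_set_sub.
- by move=> s i j; exact: node_set_disj.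
- move=> A; have [[a [aA anA]]|[c [v [s H]]]] := Cdich A; [left|right].
    exists (fun n => enc (a, n)); split.
    + move=> c; have [n ltn] : exists n, sumn [seq (dec i).2 | i <- c] < n.
        by exists (sumn [seq (dec i).2 | i <- c]).+1.
      exists n; apply/negP; elim: c ltn => //= i c IHc ltn; rewrite inE => /orP[/eqP E|].
        by move: ltn; rewrite -E encK /= ltnNge leq_addr.
      by apply: IHc; apply: leq_ltn_trans ltn; exact: leq_addl.
    + by move=> p n Ap; rewrite encK; exact: aA.
    + by move=> p /anA[n Cn]; exists n; rewrite encK.
  exists [seq enc i | i <- c], (v \o dec), s => p Dp cp; apply: H => // i ic.
  by have := cp _ (map_f enc ic); rewrite /= encK.
Qed.

(** A singleton contains no trace of a cylinder on a [D s], since such a trace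
    meets the disjoint sets [D (rcons s i)]; so it has a sacrificed block, where
    all other points have the value [true] somewhere. *)
Lemma tree_forced_code_inj (K S : Type) (L : eqType) (D : seq K -> set S) code :
  injects nat K -> @tree_forced_code K S L D code -> injective code.
Proof.
move=> [g gI] [dense sub disj dich] p q pq; apply: contrapT => npq.
have [[J [_ Jp Jnp]]|[c [v [s H]]]] := dich [set p].
  have [n qn] : exists n, code q (J n) by apply: Jnp => qp; apply: npq.
  by have := Jp p n erefl; rewrite pq qn.
have node i : exists2 r, D (rcons s i) r & r = p.
  have [r Dr cr] := dense c v (rcons s i); exists r => //.
  by apply: H => //; exact: sub Dr.
have [r0 D0 r0p] := node (g 0); have [r1 D1 r1p] := node (g 1).
have : (D (rcons s (g 0)) `&` D (rcons s (g 1))) p.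
  by split; [rewrite -r0p|rewrite -r1p].
by rewrite disj // => /gI.
Qed.

Definition code_space (S : Type) (L : choiceType) (code : S -> L -> bool) :
  set (prod_topology (fun _ : L => bool)) := range code.

Lemma code_space_open_near (S : Type) (L : choiceType) (code : S -> L -> bool)
    (O : set (set_type (code_space code))) z :
  open O -> O z -> exists c, forall w, agree c (val w) (val z) -> O w.
Proof.
move=> [O' oO' <-] Oz; have [c cO] := cube_cylinder oO' Oz.
by exists c => w /cO.
Qed.

Lemma code_space_cylinder_open (S : Type) (L : choiceType) (code : S -> L -> bool)
    (c : seq L) v : open [set w : set_type (code_space code) | agree c (val w) v].
Proof.
elim: c => [|i c IHc].
  by rewrite (_ : [set _ | _] = setT); [exact: openT|apply/seteqP; split].
rewrite (_ : [set _ | _] = val @^-1` [set z | z i = v i] `&`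
  [set w : set_type (code_space code) | agree c (val w) v]).
  apply: openI => //; exists [set z | z i = v i] => //; exact: cube_open_coordinate.
apply/seteqP; split=> [w H|w [wi H] j].
  by split=> [|j jc]; apply: H; rewrite inE ?eqxx // jc orbT.
by rewrite inE => /orP[/eqP ->|]; [|exact: H].
Qed.

(** A set with a sacrificed block is closed, its complement being the union of
    the open sets given by the value [true] at the coordinates of the block, and
    has empty interior, because a cylinder leaves some coordinate of the block
    free. *)
Lemma tree_forced_code_space (K S : Type) (L : choiceType) (D : seq K -> set S) code :
  injects nat K -> @tree_forced_code K S L D code ->
  tree_forced (fun s => [set w : set_type (code_space code) | (code @` D s) (val w)]).
Proof.
move=> natK tC; have codeI := tree_forced_code_inj natK tC.
have [dense sub disj dich] := tC.
pose X := set_type (code_space code).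
have inX p : code_space code (code p) by exists p.
pose x p : X := SigSub (mem_set (inX p)).
have xsurj (w : X) : exists p, w = x p.
  by have [p _ E] := set_valP w; exists p; apply: val_inj.
split.
- move=> s O [w Ow] oO; have [c cO] := code_space_open_near oO Ow.
  have [p Dp cp] := dense c (val w) s.
  by exists (x p); split; [exact: cO|exists p].
- by move=> s i w [p Dp pw]; exists p => //; exact: sub Dp.
- move=> s i j ij; apply/seteqP; split=> // w [[p Dp pw] [q Dq qw]].
  have pq : p = q by apply: codeI; rewrite pw qw.
  have : (D (rcons s i) `&` D (rcons s j)) p by split=> //; rewrite pq.
  by rewrite disj.
- move=> A; have [[J [Jfresh JA JnA]]|[c [v [s H]]]] := dich [set p | A (x p)].
    left; have cA : closed A.
      rewrite -[A]setCK; apply: open_closedC.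
      rewrite (_ : ~` A = \bigcup_n [set w : X | agree [:: J n] (val w) xpredT]).
        by apply: bigcup_open => n _; exact: code_space_cylinder_open.
      apply/seteqP; split=> w; have [p ->] := xsurj w.
        by move=> /JnA[n Jn]; exists n => // i; rewrite inE => /eqP ->.
      move=> [n _ /(_ (J n) (mem_head _ _)) Jn] Ap.
      by have := JA p n Ap; rewrite -[code p (J n)]/(val (x p) (J n)) Jn.
    split=> //; rewrite /nowhere_dense -(closure_id A).1 //.
    apply/seteqP; split=> // w; rewrite /interior/= nbhsE => -[O [oO Ow] OA].
    have [c cO] := code_space_open_near oO Ow; have [n nc] := Jfresh c.
    have [p _ cp] := dense (J n :: c) (fun i => (i == J n) || val w i) [::].
    have Ap : A (x p).
      apply/OA/cO => i ic; rewrite -[LHS]/(code p i) cp ?inE ?ic ?orbT //.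
      by case: eqP => // iJ; rewrite -iJ ic in nc.
    by have := JA p n Ap; rewrite cp ?mem_head // eqxx.
  right; exists [set w : X | agree c (val w) v], s; split.
  + exact: code_space_cylinder_open.
  + by have [p Dp cp] := dense c v s; exists (x p).
  + move=> w [cw [p Dp pw]]; have -> : w = x p by apply: val_inj; rewrite -pw.
    by apply: H => //; rewrite pw.
Qed.

Theorem theorem5p1 (K : Type) (infK : infinite_set [set: K]%classic) :
  exists X : set (cantor_cube K),
    [/\ C_space X,
        hereditarily_resolvable K (set_type X),
        maximally_resolvable (set_type X) &
        ~ extraresolvable (set_type X)].
Proof.
elim/Pchoice: K => K in infK *.
have natK : injects nat K by apply/card_le_setT_injects/infiniteP.
have [code tC] := tree_forced_code_exists natK.
have tX := tree_forced_code_space natK tC.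
have XK : injects (set_type (code_space code)) K.
  apply: injects_trans (injects_point natK).
  have /choice[d dP] (w : set_type (code_space code)) : exists p, code p = val w.
    by have [p _ pw] := set_valP w; exists p.
  by exists d => w w' ww'; apply: val_inj; rewrite -!dP ww'.
have X0 : [set: set_type (code_space code)] !=set0.
  have [p _ _] := code_dense tC [::] xpredT [::].
  by exists (SigSub (mem_set (imageT code p : code_space code (code p)))).
exists (code_space code); split.
- split.
  + move=> O [y Oy] oO; have [c cO] := cube_cylinder oO Oy.
    have [p _ cp] := code_dense tC c y [::].
    by exists (code p); split; [exact: cO|exists p].
  + exact: tree_forced_nodec tX.
  + exact: card_eq_trans (card_setT_sym _) (tree_forced_card tX X0 XK).
  + exact: tree_forced_nwd tX X0 XK.
  + exact: tree_forced_dispersion tX X0 XK.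
- exact: tree_forced_hereditarily_resolvable tX.
- by exists K; [exact: tree_forced_dispersion tX X0 XK|exact: tree_forced_resolvable tX X0].
- exact: tree_forced_not_extraresolvable natK tX X0 XK.
Qed.
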